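(* The stability levels of the monochromatic configurations $\mathbf 1$ and $\mathbf 2$ are \[ \mathcal V_{\mathbf 1}=\Gamma_{13}^\star,\qquad \mathcal V_{\mathbf 2}=\Gamma_{23}^\star . \]
   Context: Let $K,L$ be positive integers and let $(V,E)$ be the $K\times L$ rectangular lattice graph with periodic boundary conditions: $V=(\mathbb Z/K\mathbb Z)\times(\mathbb Z/L\mathbb Z)$ and $E$ is the set of nearest-neighbour edges. Let $0<h_1<h_2<h_3<1$ be real numbers. Standing assumptions: (A) $K$ and $L$ are both greater than $\frac{3}{h_3-h_2}$ and greater than $\frac{3}{h_2-h_1}$; (B) $a(h_2-h_1)+b(h_3-h_2)\notin\mathbb Z$ for all $(a,b)\in\mathbb Z^2\setminus\{(0,0)\}$. The configuration space is $\mathcal X=\{1,2,3\}^V$, with Hamiltonian \[ H(\sigma)=-\sum_{\{x,y\}\in E}\mathbf 1_{\{\sigma(x)=\sigma(y)\}}-\sum_{x\in V}h_{\sigma(x)} . \] For $i\in\{1,2,3\}$, $\mathbf i\in\mathcal X$ is the configuration with constant spin $i$. Two configurations are adjacent if they differ at exactly one site. A path from $\sigma$ to $\eta$ is a finite sequence of successively adjacent configurations starting at $\sigma$ and ending at $\eta$. The communication height $\Phi(\sigma,\eta)$ is the minimum over all paths from $\sigma$ to $\eta$ of the maximum of $H$ along the path; for $A\subseteq\mathcal X$, $\Phi(\sigma,A)=\min_{\eta\in A}\Phi(\sigma,\eta)$ and $\Gamma(\sigma,A)=\Phi(\sigma,A)-H(\sigma)$. The stability level of $\sigma$ is $\mathcal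 V_\sigma=\Gamma(\sigma,I_\sigma)$ with $I_\sigma=\{\eta\in\mathcal X:H(\eta)<H(\sigma)\}$, and $\mathcal V_\sigma=\infty$ if $I_\sigma=\emptyset$. For $h\in(0,1)$ let $f(h)=4\ell_c-h(\ell_c(\ell_c-1)+1)$ with $\ell_c=\lceil 2/h\rceil$. For $1\le i<j\le 3$ set $\Gamma_{ij}^\star=f(h_j-h_i)$. *)

(* Defs.v *)
From mathcomp Require Export all_boot all_order all_algebra.
From mathcomp Require Export boolp classical_sets reals constructive_ereal.

Set Implicit Arguments.
Unset Strict Implicit.
Unset Printing Implicit Defensive.

Export Order.TTheory GRing.Theory Num.Theory.
Global Open Scope ring_scope.

(* The spins 1, 2, 3 are the elements 0, 1, 2 of 'I_3. *)
Definition spin1 : 'I_3 := @Ordinal 3 0 isT.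
Definition spin2 : 'I_3 := @Ordinal 3 1 isT.
Definition spin3 : 'I_3 := @Ordinal 3 2 isT.

Section Potts.
Variables (R : realType) (K L : nat) (h : 'I_3 -> R).

(* 'I_K stands for Z/KZ: ordS i is i + 1 modulo K. *)
Definition vertex : finType := ('I_K * 'I_L)%type.

Definition neighbour (x y : vertex) : bool :=
  (x.1 == y.1) && ((y.2 == ordS x.2) || (x.2 == ordS y.2)) ||
  (x.2 == y.2) && ((y.1 == ordS x.1) || (x.1 == ordS y.1)).

(* Unordered pairs.  The guard x != y only matters if K = 1 or L = 1. *)
Definition edges : {set {set vertex}} :=
  [set e | [exists x, exists y,
    [&& x != y, neighbour x y & e == [set x; y]]]].

Definition config : finType := {ffun vertex -> 'I_3}.

Definition mono (i : 'I_3) : config := [ffun=> i].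

Definition monochromatic (s : config) (e : {set vertex}) : bool :=
  [forall x in e, forall y in e, s x == s y].

Definition hamiltonian (s : config) : R :=
  - (\sum_(e in edges) (monochromatic s e)%:R) - \sum_(x : vertex) h (s x).

Definition adjacent (s t : config) : bool := #|[set x | s x != t x]| == 1%N.

(* The path s :: p, from s to last s p. *)
Definition is_path (s t : config) (p : seq config) : bool :=
  path adjacent s p && (last s p == t).

Definition path_height (s : config) (p : seq config) : R :=
  \big[Num.max/hamiltonian s]_(u <- p) hamiltonian u.

(* The infimum is a minimum, see comm_height_min below. *)
Definition comm_height (s t : config) : R :=
  inf [set r | exists2 p, is_path s t p & r = path_height s p].

(* Value +oo on the empty set. *)
Definition comm_height_set (s : config) (A : {set config}) : \bar R :=
  \big[mine/+oo%E]_(t in A) (comm_height s t)%:E.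

Definition Gamma (s : config) (A : {set config}) : \bar R :=
  (comm_height_set s A - (hamiltonian s)%:E)%E.

Definition lower_energy (s : config) : {set config} :=
  [set t | hamiltonian t < hamiltonian s].

Definition stability_level (s : config) : \bar R :=
  if lower_energy s == finset.set0 then +oo%E else Gamma s (lower_energy s).

Lemma path_exists (s t : config) : exists p, is_path s t p.
Proof.
move E : #|[set x | s x != t x]| => n.
elim: n s E => [|n IH] s E.
  exists [::]; rewrite /is_path /=; apply/eqP/ffunP => x.
  move/eqP: E; rewrite cards_eq0 => /eqP/setP/(_ x).
  by rewrite !inE => /negbFE/eqP.
have [x] : exists x, x \in [set x | s x != t x].
  by apply/set0Pn; rewrite -cards_eq0 E.
move=> xD; have := xD; rewrite inE => sx.
pose s' : config := [ffun y => if y == x then t x else s y].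
have /IH[p /andP[pp pl]] : #|[set y | s' y != t y]| = n.
  have -> : [set y | s' y != t y] = [set y | s y != t y] :\ x.
    apply/setP => y; rewrite !inE ffunE.
    by case: (eqVneq y x) => [->|]; rewrite ?eqxx.
  by have := cardsD1 x [set x | s x != t x]; rewrite E xD add1n => -[].
exists (s' :: p); rewrite /is_path /= pp pl !andbT /adjacent.
apply/cards1P; exists x; apply/setP => y; rewrite !inE ffunE.
by case: (eqVneq y x) => [->|]; rewrite ?eqxx.
Qed.

Lemma path_height_attained (s : config) (p : seq config) :
  exists u, path_height s p = hamiltonian u.
Proof.
rewrite /path_height; elim: p => [|v p [u IH]].
  by exists s; rewrite big_nil.
by rewrite big_cons IH; case: leP => _; [exists u|exists v].
Qed.

Lemma comm_height_min (s t : config) :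
  (exists2 p, is_path s t p & path_height s p = comm_height s t) /\
  (forall p, is_path s t p -> comm_height s t <= path_height s p).
Proof.
pose P u := `[< exists2 p, is_path s t p & path_height s p = hamiltonian u >].
have [p0 p0P] := path_exists s t.
have [u0 u0E] := path_height_attained s p0.
have Pu0 : P u0 by apply/asboolP; exists p0.
case: (arg_minP hamiltonian Pu0) => u /asboolP[p pP pE] uP.
have lb q : is_path s t q -> hamiltonian u <= path_height s q.
  move=> qP; have [v vE] := path_height_attained s q.
  by rewrite vE; apply: uP; apply/asboolP; exists q.
have lbS : lbound [set r | exists2 p, is_path s t p & r = path_height s p]
    (hamiltonian u) by move=> _ [q qP ->]; exact: lb.
suff cE : comm_height s t = hamiltonian u.
  by rewrite cE; split => //; exists p.
apply/eqP; rewrite eq_le; apply/andP; split.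
- by apply: ge_inf; [exists (hamiltonian u)|exists p].
- by apply: lb_le_inf => //; exists (path_height s p), p.
Qed.

Definition critical_length (d : R) : int := Num.ceil (2 / d).

Definition critical_energy (d : R) : R :=
  let l : R := (critical_length d)%:~R in 4 * l - d * (l * (l - 1) + 1).

Definition Gamma_star (i j : 'I_3) : R := critical_energy (h j - h i).

End Potts.

Arguments mono : clear implicits.

(* Main.v *)
(* Let A be the set of sites whose spin differs from the initial spin s, let
   d = h_3 - h_s and l = ceil (2 / d), and let r and c be the numbers of rows and
   columns meeting A.  Then H(sigma) - H(s) >= per A - d |A|, with equality if the
   sites of A carry spin 3, and per A >= 2 (r + c) unless A meets all the rows or
   all the columns.

   Lower bound: as long as r, c <= l and |A| <= l (l - 1), the energy is at least
   H(s).  A path to lower energy leaves this region, and the first configuration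
   outside still has r, c <= l + 1 < K, L, hence does not wrap.  If r + c >= 2 l,
   its energy is at least H(s) + f(d) because |A| <= l (l - 1) + 1.  Otherwise,
   say, c = l + 1 and r < l - 1; the last column just received its first site, so
   |A| <= r l + 1, and this also gives at least H(s) + f(d).

   Upper bound: let a droplet of spins 3 grow through squares and quasi-squares up
   to side l, then through l x c rectangles up to a strip l x L around the torus,
   whose energy L (2 - d l) relative to s is negative. *)
From mathcomp Require Import zify lra ring.
Require Import Defs.

Set Implicit Arguments.
Unset Strict Implicit.
Unset Printing Implicit Defensive.

(** * Boundary points of subsets of a cycle *)

(* [P] is viewed as a subset of the cycle of length [n]. *)
Definition cut (n : nat) (P : pred 'I_n) : nat := #|[set j | P j != P (ordS j)]|.

Lemma ordS_invariant (n : nat) (P : pred 'I_n) (i j : 'I_n) :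
  (forall k, P k -> P (ordS k)) -> P i -> P j.
Proof.
move=> PS Pi; have Pm m : P (iter m (@ordS n) i) by elim: m => //= m /PS.
have vE m : iter m (@ordS n) i = ((i + m) %% n)%N :> nat.
  elim: m => [|m IH] /=; first by rewrite addn0 modn_small.
  by rewrite IH -addn1 modnDml addn1 addnS.
(* From [i], n - i steps lead around to 0, and [j] further steps lead to [j]. *)
have -> // : j = iter (j + (n - i)) (@ordS n) i.
apply: val_inj; rewrite /= vE addnCA subnKC ?modnDr ?modn_small //.
exact: ltnW.
Qed.

(** Going around the cycle, [P] must be left after some [a] and entered after some [b]; these differ
    because [P a] holds and [P b] fails. *)
Lemma cut_ge2 (n : nat) (P : pred 'I_n) (i j : 'I_n) :
  P i -> ~~ P j -> (2 <= cut P)%N.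
Proof.
move=> Pi nPj.
have [a Pa nPa] : exists2 a, P a & ~~ P (ordS a).
  apply: contrapT => noa; move/negP: nPj; apply; apply: ordS_invariant Pi => k Pk.
  by apply: contra_notT noa => nPk; exists k.
have [b nPb Pb] : exists2 b, ~~ P b & P (ordS b).
  apply: contrapT => nob; apply/negP: Pi; apply: (ordS_invariant (P := predC P)) nPj.
  by move=> k nPk; apply: contra_notN nob => Pk; exists k.
have ab : a != b by apply: contraNneq nPb => <-.
have <- : #|[set a; b]| = 2%N by rewrite cards2 ab.
apply/subset_leq_card/fintype.subsetP => k; rewrite !inE.
by case/orP => /eqP->; [rewrite Pa (negPf nPa)|rewrite Pb (negPf nPb)].
Qed.

(** The value can change only after position a - 1 and at the wrap from the last position to 0. *)
Lemma cut_initial_le2 (n : nat) (P : pred 'I_n) (a : nat) :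
  (forall j : 'I_n, P j = (j < a)%N) -> (cut P <= 2)%N.
Proof.
move=> PE; case: n => [|n] in P PE *.
  by rewrite /cut; apply: leq_trans (max_card _) _; rewrite card_ord.
apply: (@leq_trans #|[set inord a.-1; ord_max : 'I_n.+1]|); last first.
  by rewrite cards2; case: (_ != _).
apply/subset_leq_card/fintype.subsetP => j; rewrite !inE !PE /=.
have := ltn_ord j; rewrite ltnS leq_eqVlt => /orP[/eqP jn _|jn].
  by apply/orP; right; apply/eqP/val_inj.
rewrite modn_small ?ltnS // => ja; have E : a = j.+1 by lia.
by rewrite E /= inord_val eqxx.
Qed.

Lemma cut_const (n : nat) (P : pred 'I_n) (b : bool) :
  (forall j, P j = b) -> cut P = 0%N.
Proof.
move=> PE; apply/eqP; rewrite cards_eq0; apply/eqP/setP => j.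
by rewrite !inE !PE eqxx.
Qed.

Lemma ordS_neq (n : nat) (i : 'I_n) : (1 < n)%N -> ordS i != i.
Proof.
move=> n1; apply/eqP => /(congr1 val) /=; have := ltn_ord i.
rewrite leq_eqVlt => /orP[/eqP E|iS]; last by rewrite modn_small //; lia.
by rewrite E modnn; lia.
Qed.

Lemma ordS_ordS_neq (n : nat) (i : 'I_n) : (2 < n)%N -> ordS (ordS i) != i.
Proof.
move=> n2; apply/eqP => /(congr1 val) /=; have := ltn_ord i => iN.
rewrite -addn1 modnDml addn1; case: (ltnP i.+2 n) => iS; first by rewrite modn_small //; lia.
have -> : i.+2 = (i.+2 - n + n)%N by lia.
by rewrite modnDr modn_small; lia.
Qed.

(** * Perimeter of a set of sites on the torus *)

Section Perimeter.
Variables K L : nat.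
Implicit Types (A B : {set vertex K L}) (x : vertex K L).

(** The boolean selects the coordinate to increase, so that pairs of a site and a direction index
    the edges, each once if both sides of the torus exceed 2. *)
Definition shift (p : vertex K L * bool) : vertex K L :=
  if p.2 then (ordS p.1.1, p.1.2) else (p.1.1, ordS p.1.2).

Definition edge_of (p : vertex K L * bool) : {set vertex K L} := [set p.1; shift p].

Definition disagree (T : eqType) (s : vertex K L -> T) : {set vertex K L * bool} :=
  [set p | s p.1 != s (shift p)].

Definition perimeter A : nat := #|disagree (fun x => x \in A)|.

Definition rows A : {set 'I_K} := [set x.1 | x in A].
Definition columns A : {set 'I_L} := [set x.2 | x in A].

Lemma perimeterE A : perimeter A =
  (\sum_i cut (fun j => (i, j) \in A) + \sum_j cut (fun i => (i, j) \in A))%N.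
Proof.
rewrite /perimeter /disagree -sum1dep_card big_mkcond /=.
under [X in _ = (X + _)%N]eq_bigr do rewrite /cut -sum1dep_card big_mkcond /=.
under [X in _ = (_ + X)%N]eq_bigr do rewrite /cut -sum1dep_card big_mkcond /=.
rewrite [X in _ = (_ + X)%N]exchange_big /= !pair_bigA /= -big_split /=.
rewrite -(pair_bigA _ (fun x b => if (x \in A) != (shift (x, b) \in A) then 1 else 0)%N) /=.
by apply: eq_bigr => -[i j] _; rewrite big_bool addnC.
Qed.

Lemma card_le_rows_columns A : (#|A| <= #|rows A| * #|columns A|)%N.
Proof.
rewrite -cardsX; apply/subset_leq_card/fintype.subsetP => x xA.
by rewrite inE; apply/andP; split; apply/imsetP; exists x.
Qed.

Lemma sum_cut_ge (m n : nat) (Q : 'I_m -> pred 'I_n) (S : {set 'I_m}) :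
  (forall i, i \in S -> exists j, Q i j) -> (exists j, forall i, ~~ Q i j) ->
  (2 * #|S| <= \sum_i cut (Q i))%N.
Proof.
move=> SQ [j0 nQ]; rewrite mulnC -sum_nat_const.
rewrite [leqRHS](bigID (mem S)) /=; apply: leq_trans (leq_addr _ _).
by apply: leq_sum => i /SQ[j Qj]; exact: cut_ge2 Qj (nQ i).
Qed.

(** A missed column leaves a gap in every row that meets [A], so each such row is cut at least
    twice; a missed row does the same for the columns. *)
Lemma perimeter_ge A : (#|rows A| < K)%N -> (#|columns A| < L)%N ->
  (2 * (#|rows A| + #|columns A|) <= perimeter A)%N.
Proof.
have unhit n (S : {set 'I_n}) : (#|S| < n)%N -> exists j, j \notin S.
  move=> Sn; apply/existsP; apply: contraLR Sn.
  rewrite negb_exists -leqNgt => /forallP Sall.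
  rewrite -[leqLHS]card_ord; apply/subset_leq_card/fintype.subsetP => j _.
  by have := Sall j; rewrite negbK.
move=> /unhit[i0 i0P] /unhit[j0 j0P]; rewrite mulnDr perimeterE; apply: leq_add.
- apply: sum_cut_ge; first by move=> _ /imsetP[[i j] xA ->]; exists j.
  by exists j0 => i; apply: contra j0P => xA; apply/imsetP; exists (i, j0).
- apply: sum_cut_ge; first by move=> _ /imsetP[[i j] xA ->]; exists i.
  by exists i0 => j; apply: contra i0P => xA; apply/imsetP; exists (i0, j).
Qed.

Lemma sum_cut_le (m n k : nat) (Q : 'I_m -> pred 'I_n) (a : nat -> nat) :
  (k <= m)%N -> (forall i j, Q i j = (j < a i)%N) ->
  (forall i, (k <= i)%N -> a i = 0%N) -> (\sum_i cut (Q i) <= 2 * k)%N.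
Proof.
move=> km QE a0.
have lt i : (cut (Q i) <= if (i < k)%N then 2 else 0)%N.
  case: ltnP => ik; first exact: cut_initial_le2 (QE i).
  by rewrite (@cut_const _ _ false) // => j; rewrite QE a0.
apply: (@leq_trans (\sum_(i < m) (if (i < k)%N then 2 else 0))%N).
  exact: leq_sum.
rewrite -big_mkcond /= sum_nat_const mulnC leq_mul2l /=.
have inj : injective (widen_ord km) by move=> x y /(congr1 val) /= /val_inj.
rewrite -[leqRHS]card_ord -(card_imset _ inj).
apply/subset_leq_card/fintype.subsetP => i; rewrite unfold_in /= => ik.
by apply/imsetP; exists (Ordinal ik) => //; apply: val_inj.
Qed.

(* [a] and [b] are the row and column lengths of the Young diagram [A]. *)
Lemma perimeter_young_le A (a b : nat -> nat) (r c : nat) :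
  (r <= K)%N -> (c <= L)%N ->
  (forall i j, ((i, j) \in A) = (j < a i)%N) ->
  (forall i j, ((i, j) \in A) = (i < b j)%N) ->
  (forall i, (r <= i)%N -> a i = 0%N) -> (forall j, (c <= j)%N -> b j = 0%N) ->
  (perimeter A <= 2 * (r + c))%N.
Proof.
move=> rK cL Aa Ab a0 b0; rewrite perimeterE mulnDr; apply: leq_add.
  exact: sum_cut_le rK _ a0.
exact: sum_cut_le cL (fun j i => Ab i j) b0.
Qed.

End Perimeter.

(** * Energy in terms of perimeter and area *)

Section Energy.
Variables (R : realType) (K L : nat) (h : 'I_3 -> R).
Hypotheses (K3 : (2 < K)%N) (L3 : (2 < L)%N).
Implicit Types (A : {set vertex K L}) (s : config K L).

(** On a cycle of length 2 the steps from the two sites give the same edge. Sides above 2 exclude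
    this, as [ordS k] and [ordS (ordS k)] then both differ from [k]. *)
Lemma edge_of_inj : injective (@edge_of K L).
Proof.
move=> [[i j] b] [[i' j'] b'] E.
have /finset.setP E0 := E; have := E0 (i, j); have := E0 (shift (i, j, b)).
rewrite !inE !eqxx ?orbT /=.
move=> /esym/orP E1 /esym/orP E2; clear E0.
have hK k := ordS_neq (n := K) k (ltnW K3); have hL k := ordS_neq (n := L) k (ltnW L3).
have hK2 k := ordS_ordS_neq (n := K) k K3; have hL2 k := ordS_ordS_neq (n := L) k L3.
case: E2 => /eqP; rewrite /shift /=.
  move=> [? ?]; subst i' j'; case: E1; rewrite /shift /= => /eqP.
    case: b {E} => -[] E; first by have := hK i; rewrite E eqxx.
    by have := hL j; rewrite E eqxx.
  case: b {E}; case: b' => // -[] E; first by have := hK i; rewrite E eqxx.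
  by have := hK i; rewrite -E eqxx.
move: E1; rewrite /shift /=.
by case: b {E}; case: b' => /= E1 [? ?]; subst; move: E1;
  rewrite !xpair_eqE /= ?(negPf (hK _)) ?(negPf (hL _)) ?(negPf (hK2 _))
    ?(negPf (hL2 _)) ?andbF /=; case.
Qed.

Lemma monochromatic2 s (x y : vertex K L) :
  monochromatic s [set x; y] = (s x == s y).
Proof.
apply/forall_inP/idP => [M|/eqP E z].
  by have /forall_inP := M x (set21 x y); apply; exact: set22.
rewrite !inE => zP; apply/forall_inP => t; rewrite !inE => tP.
by case/orP: zP => /eqP->; case/orP: tP => /eqP->; rewrite ?E.
Qed.

Lemma disagreeing_edges s :
  [set e in edges K L | ~~ monochromatic s e] = @edge_of K L @: disagree s.
Proof.
apply/setP => e; apply/idP/imsetP => [|[p]].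
  rewrite !inE => /andP[/existsP[x /existsP[y /and3P[_ N /eqP->]]]].
  rewrite monochromatic2 => sxy.
  have [[b E]|[b E]] : (exists b, y = shift (x, b)) \/ (exists b, x = shift (y, b)).
    case: x y N {sxy} => [i j] [i' j']; rewrite /neighbour /=.
    case/orP => /andP[/eqP E /orP[] /eqP E']; subst.
    - by left; exists false.
    - by right; exists false.
    - by left; exists true.
    - by right; exists true.
  - by exists (x, b); rewrite ?inE /edge_of /= -?E.
  - exists (y, b); rewrite ?inE /edge_of /= -?E; first by rewrite eq_sym.
    by rewrite finset.setUC.
rewrite [p \in _]inE => sp ->; rewrite !inE /edge_of monochromatic2 sp andbT.
apply/existsP; exists p.1; apply/existsP; exists (shift p).
rewrite eqxx andbT (contraNneq _ sp) => [|->] //.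
by case: p {sp} => -[i j] []; rewrite /neighbour /shift /= !eqxx ?orbT.
Qed.

Lemma hamiltonianE s : hamiltonian h s =
  #|disagree s|%:R - #|edges K L|%:R - \sum_x h (s x).
Proof.
congr (_ - _); rewrite -(card_imset _ edge_of_inj) -disagreeing_edges.
rewrite -(cardsID [set e | monochromatic s e] (edges K L)).
rewrite -natr_sum -big_mkcondr /= sum1dep_card natrD.
rewrite [X in X%:R - _](_ : _ = #|edges K L :\: [set e | monochromatic s e]|).
  rewrite [X in - X%:R = _](_ : _ = #|edges K L :&: [set e | monochromatic s e]|).
    by ring.
  by apply: eq_card => e; rewrite !inE.
by apply: eq_card => e; rewrite !inE andbC.
Qed.

Lemma hamiltonian_sub_mono s i :
  hamiltonian h s - hamiltonian h (mono K L i) =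
  #|disagree s|%:R - \sum_x (h (s x) - h i).
Proof.
have -> : hamiltonian h (mono K L i) = 0 - #|edges K L|%:R - \sum_(x : vertex K L) h i.
  rewrite hamiltonianE (_ : disagree _ = finset.set0) ?cards0; last first.
    by apply/setP => p; rewrite !inE !ffunE eqxx.
  by under eq_bigr do rewrite ffunE.
by rewrite hamiltonianE sumrB; ring.
Qed.

Definition foreign s (i : 'I_3) : {set vertex K L} := [set x | s x != i].

(** A boundary edge of the foreign set joins spin [i] to another spin, hence disagrees, and a
    foreign site gains at most [h spin3 - h i] from the field. Disagreements between two foreign
    spins only raise the energy. *)
Lemma hamiltonian_ge s i : (forall k, h k <= h spin3) ->
  hamiltonian h (mono K L i) +
    ((perimeter (foreign s i))%:R - (h spin3 - h i) * #|foreign s i|%:R)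
  <= hamiltonian h s.
Proof.
move=> hmax; rewrite addrC -lerBrDr hamiltonian_sub_mono lerB //.
  rewrite ler_nat; apply/subset_leq_card/fintype.subsetP => p; rewrite !inE.
  by apply: contraNneq => ->.
rewrite -sum1_card natr_sum mulr_sumr.
rewrite [leLHS](bigID (mem (foreign s i))) /= [X in _ + X]big1 ?addr0.
  by apply: ler_sum => x _; rewrite mulr1 lerB.
by move=> x; rewrite inE negbK => /eqP->; rewrite subrr.
Qed.

Definition droplet (i : 'I_3) A : config K L :=
  [ffun x => if x \in A then spin3 else i].

Lemma hamiltonian_droplet i A : i != spin3 ->
  hamiltonian h (droplet i A) =
  hamiltonian h (mono K L i) + ((perimeter A)%:R - (h spin3 - h i) * #|A|%:R).
Proof.
move=> i3; apply/eqP; rewrite addrC -subr_eq hamiltonian_sub_mono; apply/eqP.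
congr (_%:R - _).
  apply: eq_card => p; rewrite !inE !ffunE.
  by case: (p.1 \in A); case: (shift p \in A); rewrite ?eqxx // eq_sym.
rewrite -sum1_card natr_sum mulr_sumr (bigID (mem A)) /= [X in _ + X]big1 ?addr0.
  by apply: eq_bigr => x xA; rewrite ffunE xA mulr1.
by move=> x /negPf xA; rewrite ffunE xA subrr.
Qed.

End Energy.

(** * Paths and their heights *)

Section Paths.
Variables (R : realType) (K L : nat) (h : 'I_3 -> R).
Implicit Types (s t u : config K L) (p : seq (config K L)).

Lemma path_height_leP s p (B : R) :
  (path_height h s p <= B) =
  (hamiltonian h s <= B) && all (fun u => hamiltonian h u <= B) p.
Proof.
rewrite /path_height; elim: p => [|u p IH]; first by rewrite big_nil andbT.
by rewrite big_cons ge_max IH /= andbCA.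
Qed.

Lemma path_exit (P : pred (config K L)) s p (B : R) :
  path (@adjacent K L) s p -> P s -> ~~ P (last s p) ->
  (forall u v, P u -> ~~ P v -> adjacent u v -> B <= hamiltonian h v) ->
  B <= path_height h s p.
Proof.
move=> pp Ps nP exitB.
have [v vp Bv] : exists2 v, v \in p & B <= hamiltonian h v.
  elim: p s pp Ps nP => /= [|u p IH] s; first by move=> _ ->.
  move=> /andP[su pp] Ps nP; have [Pu|nPu] := boolP (P u).
    by have [v vp Bv] := IH _ pp Pu nP; exists v => //; rewrite inE vp orbT.
  by exists u; [rewrite inE eqxx|exact: exitB su].
have := lexx (path_height h s p); rewrite {1}path_height_leP => /andP[_ /allP].
by move=> /(_ v vp); exact: le_trans.
Qed.

Definition reachable s (B : R) t : Prop :=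
  exists2 p, is_path s t p & path_height h s p <= B.

Lemma reachable_step s (B : R) t u :
  reachable s B t -> adjacent t u -> hamiltonian h u <= B -> reachable s B u.
Proof.
move=> [p /andP[pp /eqP pl] pB] tu uB; exists (rcons p u).
  by rewrite /is_path rcons_path last_rcons pp pl tu eqxx.
by move: pB; rewrite !path_height_leP all_rcons uB.
Qed.

End Paths.

(** * Energy bounds around the critical size *)

Section Critical.
Variables (R : realType) (K L l : nat) (d : R).
Hypotheses (lK : (l.+1 < K)%N) (lL : (l.+1 < L)%N).
Hypotheses (d_ge0 : 0 <= d) (dl_ge2 : 2 <= d * l%:R) (dl_lt2 : d * (l%:R - 1) < 2).
Implicit Types A B : {set vertex K L}.

Let barrier : R := 4 * l%:R - d * (l%:R * (l%:R - 1) + 1).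

(* On the torus a bound on the number of sites alone would not do: near the
   critical size a strip wrapping around the torus can have a smaller perimeter
   than a square.  Bounding both sides by [l] keeps [A], and every set reached
   from it in one step, away from wrapping. *)
Definition subcritical A : bool :=
  [&& #|rows A| <= l, #|columns A| <= l & #|A| <= l * (l - 1)]%N.

Lemma critical_side_gt0 : (0 < l)%N.
Proof. by case: l dl_ge2 => //; rewrite mulr0; lra. Qed.

(** If one side r is below [l], then d r <= 2 and d |A| <= d r c <= 2 c, which the perimeter covers.
    If both sides equal [l], the area bound gives d |A| <= d l (l - 1) <= 2 l. *)
Lemma subcritical_energy A : subcritical A -> 0 <= (perimeter A)%:R - d * #|A|%:R.
Proof.
have [d0 dl2 dl3] := And3 d_ge0 dl_ge2 dl_lt2.
move=> /and3P[rl cl nl].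
have := perimeter_ge (A := A) ltac:(lia) ltac:(lia).
have := card_le_rows_columns A; move: (#|rows A|) (#|columns A|) rl cl => r c rl cl.
rewrite -(ler_nat R) natrM => nrc; rewrite -(ler_nat R) natrM natrD => per.
have l0 := critical_side_gt0; have lR : 1 <= l%:R :> R by rewrite ler1n.
have dn : d * #|A|%:R <= d * (r%:R * c%:R) by rewrite ler_wpM2l.
have r0 : 0 <= r%:R :> R by []. have c0 : 0 <= c%:R :> R by [].
have side k : (k < l)%N -> d * k%:R <= 2.
  move=> kl; apply: le_trans (ltW dl_lt2); rewrite ler_wpM2l //.
  by rewrite lerBrDr natr1 ler_nat.
have [rl'|rl'] := ltnP r l; first by have := side r rl'; nra.
have [cl'|cl'] := ltnP c l; first by have := side c cl'; nra.
have rE : r = l by apply/eqP; rewrite eqn_leq rl.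
have cE : c = l by apply/eqP; rewrite eqn_leq cl.
move: nl; rewrite -(ler_nat R) natrM natrB // => nl.
have : d * #|A|%:R <= d * (l%:R * (l%:R - 1)) by rewrite ler_wpM2l.
have : l%:R * (d * (l%:R - 1)) <= l%:R * 2 by rewrite ler_wpM2l // ltW.
by move: per; rewrite rE cE; lra.
Qed.

(* After replacing [n] by its bound, the slack is [(d * l - 2) * (l - 1 - r)]. *)
Lemma wide_energy (r n : nat) : (r < l)%N -> (n <= r * l + 1)%N ->
  barrier <= 2 * (r%:R + l.+1%:R) - d * n%:R.
Proof.
have [d0 dl2 dl3] := And3 d_ge0 dl_ge2 dl_lt2.
rewrite -(ler_nat R) -natr1 => rl; rewrite -(ler_nat R) natrD natrM => nl.
have dn : d * n%:R <= d * (r%:R * l%:R + 1) by rewrite ler_wpM2l.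
have : 0 <= (d * l%:R - 2) * (l%:R - 1 - r%:R) by apply: mulr_ge0; lra.
by rewrite /barrier -[l.+1%:R]natr1; lra.
Qed.

Lemma card_rows_add A B x : A :\ x \subset B -> (#|rows A| <= #|rows B|.+1)%N.
Proof.
move=> AB; have : rows A \subset x.1 |: rows B.
  apply/fintype.subsetP => _ /imsetP[y yA ->]; rewrite !inE.
  have [->|yx] := eqVneq y x; first by rewrite eqxx.
  rewrite [_ \in rows B]imset_f ?orbT //.
  by apply: (fintype.subsetP AB); rewrite !inE yx.
move=> /subset_leq_card /leq_trans; apply; apply: leq_trans (leq_card_setU _ _) _.
by rewrite cards1.
Qed.

Lemma card_columns_add A B x :
  A :\ x \subset B -> (#|columns A| <= #|columns B|.+1)%N.
Proof.
move=> AB; have : columns A \subset x.2 |: columns B.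
  apply/fintype.subsetP => _ /imsetP[y yA ->]; rewrite !inE.
  have [->|yx] := eqVneq y x; first by rewrite eqxx.
  rewrite [_ \in columns B]imset_f ?orbT //.
  by apply: (fintype.subsetP AB); rewrite !inE yx.
move=> /subset_leq_card /leq_trans; apply; apply: leq_trans (leq_card_setU _ _) _.
by rewrite cards1.
Qed.

(** Inclusion up to the site [x] covers every spin flip at [x]: the site may become foreign, cease
    to be so, or keep its status. *)
Lemma exit_energy A B x : subcritical B -> ~~ subcritical A -> A :\ x \subset B ->
  barrier <= (perimeter A)%:R - d * #|A|%:R.
Proof.
have [d0 dl2 dl3] := And3 d_ge0 dl_ge2 dl_lt2.
move=> /and3P[rB cB nB] nsA AB.
have rA := card_rows_add AB; have cA := card_columns_add AB.
have nAx : (#|A| <= #|A :\ x|.+1)%N by rewrite (cardsD1 x A); case: (x \in A).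
have nA : (#|A| <= l * (l - 1) + 1)%N.
  by have := subset_leq_card AB; lia.
have l0 := critical_side_gt0.
have := perimeter_ge (A := A) ltac:(lia) ltac:(lia).
rewrite -(ler_nat R) natrM natrD => per.
have [big|small] := leqP (2 * l) (#|rows A| + #|columns A|).
  move: nA big; rewrite -(ler_nat R) natrD natrM natrB // => nA.
  rewrite -(ler_nat R) natrM natrD => big.
  have dn : d * #|A|%:R <= d * (l%:R * (l%:R - 1) + 1) by rewrite ler_wpM2l.
  by rewrite /barrier; lra.
have rx : (#|rows (A :\ x)| <= #|rows A|)%N.
  by apply/subset_leq_card/imsetS/subD1set.
have cx : (#|columns (A :\ x)| <= #|columns A|)%N.
  by apply/subset_leq_card/imsetS/subD1set.
have rxB : (#|rows (A :\ x)| <= #|rows B|)%N by apply/subset_leq_card/imsetS.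
have cxB : (#|columns (A :\ x)| <= #|columns B|)%N by apply/subset_leq_card/imsetS.
have nx := card_le_rows_columns (A :\ x).
have [cl|cl] := ltnP l #|columns A|.
  (* Without [x] at most [l] columns are met, so the remaining area is at most [l] times the number
     of rows. *)
  have n1 : (#|A| <= #|rows A| * l + 1)%N.
    rewrite addn1; apply: leq_trans nAx _; rewrite ltnS; apply: leq_trans nx _.
    by apply: leq_mul => //; lia.
  have := wide_energy (r := #|rows A|) ltac:(lia) n1.
  have E : #|columns A| = l.+1 by lia.
  by move: per; rewrite E; lra.
have [rl|rl] := ltnP l #|rows A|.
  have n1 : (#|A| <= #|columns A| * l + 1)%N.
    rewrite addn1 mulnC; apply: leq_trans nAx _; rewrite ltnS; apply: leq_trans nx _.
    by apply: leq_mul => //; lia.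
  have := wide_energy (r := #|columns A|) ltac:(lia) n1.
  have E : #|rows A| = l.+1 by lia.
  by move: per; rewrite E; lra.
(* No side exceeds [l], so only the area bound can fail. But the sides sum to less than 2 l, so one
   is below [l] and the area is at most l (l - 1). *)
move: nsA; rewrite /subcritical rl cl /= -ltnNge => nA'.
have := leq_trans nA' (card_le_rows_columns A); rewrite ltnNge => /negP[].
have [rl'|rl'] := ltnP #|rows A| l; last by apply: leq_mul => //; lia.
by rewrite mulnC; apply: leq_mul => //; lia.
Qed.

(** These bound the energy once the first site of a new side is placed: a column added to an a x a
    square, then a row added to an a x (a + 1) rectangle. *)
Lemma square_energy (a : nat) : (a < l)%N ->
  2 * (a + a.+1)%:R - d * (a * a + 1)%:R <= barrier /\
  2 * (a.+1 + a.+1)%:R - d * (a * a.+1 + 1)%:R <= barrier.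
Proof.
have [d0 dl2 dl3] := And3 d_ge0 dl_ge2 dl_lt2.
move=> al.
(* With m = a + 1 the left side is the barrier formula at m instead of [l]; the difference is (l -
   m) (4 - d (l + m - 1)), whose second factor can be negative only for m = l. *)
have key : 4 * a.+1%:R - d * (a.+1%:R * a%:R + 1) <= barrier.
  have [E|al'] := eqVneq a.+1 l; first by (rewrite /barrier -E -[a.+1%:R]natr1; lra).
  have : (a.+2 <= l)%N by rewrite ltn_neqAle al' al.
  rewrite -(ler_nat R) -[a.+2%:R]natr1 => al2.
  have a1 : a.+1%:R - 1 = a%:R :> R by rewrite -natr1; ring.
  have : 0 <= (l%:R - a.+1%:R) * (4 - d * (l%:R + a.+1%:R - 1)).
    apply: mulr_ge0; first lra.
    have : d * (a.+1%:R + 1) <= d * l%:R by rewrite ler_wpM2l.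
    lra.
  by rewrite /barrier -a1; lra.
have da : d * a%:R <= 2.
  apply: le_trans (ltW dl_lt2); rewrite ler_wpM2l //.
  by rewrite lerBrDr natr1 ler_nat.
rewrite !natrD !natrM; move: key; rewrite -[a.+1%:R]natr1; split; lra.
Qed.

(** The slack is (d l - 2) (c + 1 - l). *)
Lemma strip_energy (c : nat) : (l <= c)%N ->
  2 * (l + c.+1)%:R - d * (l * c + 1)%:R <= barrier.
Proof.
have [d0 dl2 dl3] := And3 d_ge0 dl_ge2 dl_lt2.
rewrite -(ler_nat R) => lc; rewrite !natrD natrM -[c.+1%:R]natr1 /barrier.
have : 0 <= (d * l%:R - 2) * (c%:R + 1 - l%:R) by apply: mulr_ge0; lra.
by lra.
Qed.

End Critical.

(** * Growth of a droplet of spins 3 *)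

Section Growth.
Variables (R : realType) (K L : nat) (h : 'I_3 -> R) (i : 'I_3) (f : R).
Hypotheses (K3 : (2 < K)%N) (L3 : (2 < L)%N) (i3 : i != spin3).
Hypothesis d_ge0 : 0 <= h spin3 - h i.

Let d : R := h spin3 - h i.

Definition nucleated (A : {set vertex K L}) : Prop :=
  reachable h (mono K L i) (hamiltonian h (mono K L i) + f) (droplet i A).

Lemma adjacent_droplet (A : {set vertex K L}) x :
  x \notin A -> adjacent (droplet i A) (droplet i (x |: A)).
Proof.
move=> xA; apply/cards1P; exists x; apply/setP => y; rewrite !inE !ffunE !inE.
have [->|yx] /= := eqVneq y x; first by rewrite (negPf xA) i3.
by rewrite eqxx.
Qed.

(** One inequality controls a whole new side: its sites share the perimeter bound [P], and the area
    is smallest just after the first site is added. *)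
Lemma nucleated_grow (A : nat -> {set vertex K L}) (k P : nat) :
  (forall m, (m < k)%N -> exists2 x, x \notin A m & A m.+1 = x |: A m) ->
  (forall m, (m <= k)%N -> (perimeter (A m) <= P)%N) ->
  P%:R - d * (#|A 0%N| + 1)%:R <= f ->
  nucleated (A 0%N) -> nucleated (A k) /\ #|A k| = (#|A 0%N| + k)%N.
Proof.
move=> step per Pf A0; suff H m : (m <= k)%N ->
    nucleated (A m) /\ #|A m| = (#|A 0%N| + m)%N by exact: H.
elim: m => [|m IH] mk; first by rewrite addn0.
have [nm cm] := IH (ltnW mk); have [x xA AE] := step m mk.
have cE : #|A m.+1| = (#|A 0%N| + m.+1)%N by rewrite AE cardsU1 xA cm; lia.
split => //; apply: reachable_step nm _ _.
  by rewrite AE; exact: adjacent_droplet.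
rewrite hamiltonian_droplet // lerD2l; apply: le_trans Pf; apply: lerB.
  by rewrite ler_nat; exact: per.
by rewrite cE ler_wpM2l // ler_nat; lia.
Qed.

Definition rect (r c : nat) : {set vertex K L} :=
  [set x : vertex K L | (x.1 < r)%N && (x.2 < c)%N].

Definition full_rect (r c : nat) : Prop :=
  nucleated (rect r c) /\ #|rect r c| = (r * c)%N.

(** The column is filled in order from row 0, so every intermediate set is a Young diagram in an r x
    (c + 1) box. Only an upper bound on the perimeter is used, so the new column may close up around
    the torus. *)
Lemma nucleated_column (r c : nat) : (r <= K)%N -> (c < L)%N ->
  2 * (r + c.+1)%:R - d * (r * c + 1)%:R <= f ->
  full_rect r c -> full_rect r c.+1.
Proof.
move=> rK cL rcf [nrc crc].
pose A m : {set vertex K L} := rect r c :|: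
  [set x : vertex K L | (x.1 < m)%N && (x.2 == c :> nat)].
have A0 : A 0%N = rect r c by apply/setP => x; rewrite !inE orbF.
have Ar : A r = rect r c.+1.
  by apply/setP => x; rewrite !inE ltnS [(x.2 <= c)%N]leq_eqVlt andb_orr orbC.
have [] := @nucleated_grow A r (2 * (r + c.+1)); rewrite ?A0 ?crc ?Ar //.
- move=> m mr; exists (Ordinal (leq_trans mr rK), Ordinal cL).
    by rewrite !inE /= !ltnn andbF.
  apply/setP => -[x y]; rewrite !inE xpair_eqE -!val_eqE /=.
  rewrite ltnS [(x <= m)%N]leq_eqVlt.
  by case: (_ == m); case: (_ == c); rewrite ?andbT ?andbF ?orbF //= orbC.
- move=> m mr; apply: (@perimeter_young_le _ _ _
    (fun x => if (x < r)%N then (if (x < m)%N then c.+1 else c) else 0)%N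
    (fun y => if (y < c)%N then r else if y == c then m else 0)%N) => //.
  + move=> x y; rewrite !inE /=; case: (ltnP x r); case: (ltnP x m); lia.
  + move=> x y; rewrite !inE /=; case: (ltnP y c); case: (eqVneq (y : nat) c); lia.
  + by move=> x; rewrite leqNgt => /negPf->.
  + by move=> y cy; rewrite ltnNge ltnW //= gtn_eqF.
- by rewrite natrM.
- by move=> nuc card; split => //; rewrite card mulnS addnC.
Qed.

Lemma nucleated_row (r c : nat) : (r < K)%N -> (c <= L)%N ->
  2 * (r.+1 + c)%:R - d * (r * c + 1)%:R <= f ->
  full_rect r c -> full_rect r.+1 c.
Proof.
move=> rK cL rcf [nrc crc].
pose A m : {set vertex K L} := rect r c :|:
  [set x : vertex K L | (x.1 == r :> nat) && (x.2 < m)%N].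
have A0 : A 0%N = rect r c by apply/setP => x; rewrite !inE andbF orbF.
have Ac : A c = rect r.+1 c.
  by apply/setP => x; rewrite !inE ltnS [(x.1 <= r)%N]leq_eqVlt andb_orl orbC.
have [] := @nucleated_grow A c (2 * (r.+1 + c)); rewrite ?A0 ?crc ?Ac //.
- move=> m mc; exists (Ordinal rK, Ordinal (leq_trans mc cL)).
    by rewrite !inE /= !ltnn andbF.
  apply/setP => -[x y]; rewrite !inE xpair_eqE -!val_eqE /=.
  rewrite ltnS [(y <= m)%N]leq_eqVlt.
  by case: (_ == m); case: (_ == r); rewrite ?andbT ?andbF ?orbF //= orbC.
- move=> m mc; apply: (@perimeter_young_le _ _ _
    (fun x => if (x < r)%N then c else if x == r then m else 0)%N
    (fun y => if (y < c)%N then (if (y < m)%N then r.+1 else r) else 0)%N) => //.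
  + move=> x y; rewrite !inE /=; case: (ltnP x r); case: (eqVneq (x : nat) r); lia.
  + move=> x y; rewrite !inE /=; case: (ltnP y c); case: (ltnP y m); lia.
  + by move=> x rx; rewrite ltnNge ltnW //= gtn_eqF.
  + by move=> y; rewrite leqNgt => /negPf->.
- by rewrite natrM.
- by move=> nuc card; split => //; rewrite card mulSn addnC.
Qed.

(** Every row is full or empty, hence uncut, and each of the [L] columns is cut at most twice. *)
Lemma perimeter_strip (r : nat) : (perimeter (rect r L) <= 2 * L)%N.
Proof.
rewrite perimeterE big1 ?add0n => [|x _]; last first.
  by apply: (cut_const (b := (x < r)%N)) => y; rewrite !inE /= ltn_ord andbT.
have -> : (2 * L = \sum_(y < L) 2)%N by rewrite sum_nat_const card_ord mulnC.
apply: leq_sum => y _; apply: (cut_initial_le2 (a := r)) => x.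
by rewrite !inE /= ltn_ord andbT.
Qed.

End Growth.

(** * Stability level of a constant configuration *)

Section Stability.
Variables (R : realType) (K L : nat) (h : 'I_3 -> R) (i : 'I_3) (l : nat).

Let d : R := h spin3 - h i.

Lemma stability_level_mono :
  (forall k, h k <= h spin3) -> (l.+1 < K)%N -> (l.+1 < L)%N ->
  0 < d < 1 -> 2 < d * l%:R -> d * (l%:R - 1) < 2 ->
  stability_level h (mono K L i) =
    (4 * l%:R - d * (l%:R * (l%:R - 1) + 1))%:E.
Proof.
set f := 4 * l%:R - _ => hmax lK lL /andP[d0 d1] dl_gt2 dl_lt2; have dl_ge2 := ltW dl_gt2.
have l0 := critical_side_gt0 dl_ge2.
have K3 : (2 < K)%N by lia.
have L3 : (2 < L)%N by lia.
have i3 : i != spin3 by apply: contraTneq d0 => E; rewrite /d E subrr ltxx.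
have dge : 0 <= h spin3 - h i by exact: ltW.
set s := mono K L i.
have up : exists2 t, t \in lower_energy h s &
    comm_height h s t <= hamiltonian h s + f.
  have rect0 : full_rect K L h i f 0 0.
    have r0 : rect K L 0 0 = finset.set0 by apply/setP => x; rewrite !inE.
    split; last by rewrite r0 cards0.
    exists [::].
      rewrite /is_path /= r0; apply/eqP/ffunP => x.
      by rewrite !ffunE inE.
    rewrite path_height_leP andbT lerDl.
    (* The case a = 0 gives 4 - d <= f, and d < 1 makes the left side positive, so the starting
       point lies below the bound. *)
    have [_] := square_energy (ltW d0) dl_ge2 dl_lt2 l0; apply: le_trans.
    by rewrite mul0n; lra.
  have square a : (a <= l)%N -> full_rect K L h i f a a.
    elim: a => // a IH al.
    have [col row] := square_energy (ltW d0) dl_ge2 dl_lt2 al.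
    (* Read backwards: a column is added first, then the row that restores the square. *)
    apply: nucleated_row => //; [lia|lia|].
    apply: nucleated_column => //; [lia|lia|]. 
    by apply: IH; lia.
  have strip c : (l <= c)%N -> (c <= L)%N -> full_rect K L h i f l c.
    elim: c => [|c IH]; first by lia.
    rewrite leq_eqVlt => /orP[/eqP <- _|]; first exact: square.
    rewrite ltnS => lc cL; apply: nucleated_column => //; first by lia.
      exact: (strip_energy (ltW d0) dl_ge2 dl_lt2 lc).
    by apply: IH => //; lia.
  have [[p pp pf] cE] := strip L ltac:(lia) (leqnn L).
  exists (droplet i (rect K L l L)); last first.
    by apply: le_trans pf; exact: (comm_height_min h _ _).2.
  rewrite inE hamiltonian_droplet // gtrDl cE subr_lt0.
  (* The strip has energy at most L (2 - d l) relative to [s]; the strict inequality 2 < d l makes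
     this negative. *)
  apply: (@le_lt_trans _ _ (2 * L)%:R); first by rewrite ler_nat perimeter_strip.
  by rewrite !natrM mulrA ltr_pM2r // ltr0n; lia.
have low t : t \in lower_energy h s -> hamiltonian h s + f <= comm_height h s t.
  rewrite inE => ts; have [[p /andP[pp /eqP pl] <-] _] := comm_height_min h s t.
  apply: (path_exit (P := fun u => subcritical l (foreign u i)) pp).
  - have -> : foreign s i = finset.set0.
      by apply/setP => x; rewrite !inE ffunE eqxx.
    by rewrite /subcritical /rows /columns !imset0 !cards0.
  (* A subcritical endpoint would have energy at least that of [s]. *)
  - apply/negP; rewrite pl => /subcritical_energy sE.
    move: ts; rewrite ltNge => /negP[].
    apply: le_trans (hamiltonian_ge K3 L3 t i hmax); rewrite lerDl.
    by apply: sE.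
  - move=> u v Pu nPv /cards1P[x uv].
    apply: le_trans (hamiltonian_ge K3 L3 v i hmax); rewrite lerD2l.
    apply: (@exit_energy R K L l d lK lL dge dl_ge2 dl_lt2 _ _ x Pu nPv).
    apply/fintype.subsetP => y; rewrite !inE => /andP[yx].
    by move/setP/(_ y): uv; rewrite !inE (negPf yx) => /negbFE/eqP->.
have [t tl tf] := up; rewrite /stability_level.
case: ifP => [/eqP E|_]; first by rewrite E inE in tl.
suff E : comm_height_set h s (lower_energy h s) = (hamiltonian h s + f)%:E.
  by rewrite /Gamma E -EFinB; congr EFin; rewrite addrC addKr.
apply/eqP; rewrite eq_le; apply/andP; split.
  by apply: (bigmin_inf t) => //; rewrite lee_fin.
by apply/bigmin_geP; split; [rewrite leey|move=> u ul; rewrite lee_fin low].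
Qed.

End Stability.

(** * The critical length and its fit in the torus *)

Lemma critical_lengthP (R : realType) (d : R) : 0 < d ->
  exists l : nat, [/\ critical_length d = l, 2 <= d * l%:R & d * (l%:R - 1) < 2].
Proof.
move=> d0; have /andP[lt le] := ceil_itv (2 / d).
have l0 : 0 < critical_length d.
  by rewrite -(ltr0z R); apply: lt_le_trans le; rewrite divr_gt0.
move: lt le l0; rewrite -/(critical_length d).
case: (critical_length d) => // l lt le _; exists l; split => //.
  by rewrite mulrC -ler_pdivrMr.
by rewrite mulrC -ltr_pdivlMr //; move: lt; rewrite intrB.
Qed.

(** If K <= l + 1, then 3 < d K < 2 + 2 d, so d > 1/2 and e < 1/2. Then 3 < e K forces K > 6, hence
    l >= 6 and d (l - 1) >= 5/2, a contradiction. *)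
Lemma critical_length_fits (R : realType) (d e : R) (K l : nat) :
  0 < d -> 0 < e -> d + e < 1 -> 3 / d < K%:R -> 3 / e < K%:R ->
  d * (l%:R - 1) < 2 -> (l.+1 < K)%N.
Proof.
move=> d0 e0 de; rewrite ltr_pdivrMr // ltr_pdivrMr // => Kd Ke dl.
rewrite ltnNge; apply/negP => Kl.
have Klr : K%:R <= l%:R + 1 :> R by rewrite natr1 ler_nat.
have d2 : 1 / 2 < d by nra.
have K6 : (6 < K)%N by rewrite -(ltr_nat R); nra.
have l5 : 6 <= l%:R :> R by rewrite ler_nat; lia.
by nra.
Qed.

Theorem theorem2p2 (R : realType) (K L : nat) (h : 'I_3 -> R)
  (hK : (0 < K)%N) (hL : (0 < L)%N)
  (h1_gt0 : 0 < h spin1) (h12 : h spin1 < h spin2)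
  (h23 : h spin2 < h spin3) (h3_lt1 : h spin3 < 1)
  (hA : [/\ 3 / (h spin3 - h spin2) < K%:R, 3 / (h spin2 - h spin1) < K%:R,
            3 / (h spin3 - h spin2) < L%:R & 3 / (h spin2 - h spin1) < L%:R])
  (hB : forall a b : int, (a, b) != (0, 0) ->
     a%:~R * (h spin2 - h spin1) + b%:~R * (h spin3 - h spin2)
       \isn't a Num.int) :
  stability_level h (mono K L spin1) = (Gamma_star h spin1 spin3)%:E /\
  stability_level h (mono K L spin2) = (Gamma_star h spin2 spin3)%:E.
Proof.
have [Kd Ke Ld Le] := hA.
have d0 : 0 < h spin3 - h spin2 by lra.
have e0 : 0 < h spin2 - h spin1 by lra.
have de : h spin3 - h spin2 + (h spin2 - h spin1) < 1 by lra.
have hmax k : h k <= h spin3.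
  have : [|| k == spin1, k == spin2 | k == spin3] by case: k => -[|[|[|]]].
  by case/or3P => /eqP->; lra.
have main i : (i == spin1) || (i == spin2) ->
    stability_level h (mono K L i) = (Gamma_star h i spin3)%:E.
  move=> i12.
  have di : h spin3 - h spin2 <= h spin3 - h i < 1.
    by case/orP: i12 => /eqP->; apply/andP; split; lra.
  have [l [lE dl dl1]] := @critical_lengthP R (h spin3 - h i) ltac:(lra).
  have l_gt0 : (0 < l)%N by case: l dl {lE dl1} => //; rewrite mulr0; lra.
  (* Assumption (B) excludes equality: d l is the combination with coefficients (l, l) for spin 1
     and (0, l) for spin 2, and 2 is an integer. *)
  have dl_neq2 : (h spin3 - h i) * l%:R != 2.
    have l_neq0 (a : int) : (a, l%:Z) != (0, 0).
      by rewrite xpair_eqE eqz_nat -[l == 0%N]negbK -lt0n l_gt0 andbF.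
    apply/eqP => dl2; case/orP: i12 => /eqP iE; rewrite iE in dl2.
      have /negP[] := hB l l (l_neq0 l).
      rewrite -mulrDr addrC subrKA mulrC [_ * _]dl2.
      exact: (intr_int R 2).
    have /negP[] := hB 0 l (l_neq0 0).
    rewrite mul0r add0r mulrC [_ * _]dl2.
    exact: (intr_int R 2).
  (* The bound passes from h_3 - h_i to h_3 - h_2, which is no larger and is one of the gaps in
     assumption (A). *)
  have fits : (h spin3 - h spin2) * (l%:R - 1) < 2.
    apply: le_lt_trans dl1; apply: ler_wpM2r; last by case/andP: di.
    by rewrite subr_ge0 ler1n.
  rewrite (stability_level_mono (l := l)) //.
  - by rewrite /Gamma_star /critical_energy lE.
  - exact: critical_length_fits de Kd Ke fits.
  - exact: critical_length_fits de Ld Le fits.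
  - by lra.
  - by rewrite lt_neqAle eq_sym dl_neq2.
by split; apply: main; rewrite eqxx ?orbT.
Qed.
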